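(* Any universally strongly group-strategyproof randomized mechanism for binary classification with shared inputs has an infinite approximation ratio; that is, there is no finite $\rho$ for which the mechanism is $\rho$-approximate.
   Context: Binary classification with shared inputs is the following problem. There are an input space $\mathcal{X}$, a concept class $\mathcal{H}$ of classifiers, each classifier $h\in\mathcal{H}$ being a function from $\mathcal{X}$ to $\{+,-\}$, and $n$ agents. The training set consists of a set of points $X\subseteq\mathcal{X}$, shared by all agents, and of a labeling $Y_i:X\to\{+,-\}$ provided by each agent $i\in[n]=\{1,\dots,n\}$. The labelings are not required to be realizable, i.e., $Y_i$ need not coincide on $X$ with any classifier of $\mathcal{H}$. The dataset is $Y=(Y_1,\dots,Y_n)$. Each agent $i$ has a weight $w_i>0$, with $\sum_{i\in[n]}w_i=1$; write $\mathbf{w}=(w_1,\dots,w_n)$. The loss of agent $i$ for a classifier $h\in\mathcal{H}$ is $\ell_i(h,Y_i)=|\{x\in X: h(x)\neq Y_i(x)\}|$, and the global risk of $h$ is $L(h,Y,\mathbf{w})=\sum_{i\in[n]}w_i\,\ell_i(h,Y_i)$. Empirical risk minimization returns a classifier $\mathrm{erm}(Y,\mathbf{w})\in\arg\min_{h\in\mathcal{H}}L(h,Y,\mathbf{w})$. A deterministic classification mechanism $M$ takes as input the dataset $Y$ and the weight vector $\mathbf{w}$ and returns a classifier $M(Y,\mathbf{w})\in\mathcal{H}$. It is strongly group-strategyproof if there are no dataset $Y$ of private labelings, subset of agents $S\subseteq[n]$, agent $i^*\in S$, and labelings $Y'_i:X\to\{+,-\}$ for $i\in S$ such that $\ell_i(M(Y,\mathbf{w}),Y_i)\ge\ell_i(M((Y_{-S},Y'_S),\mathbf{w}),Y_i)$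 for each $i\in S$ and $\ell_{i^*}(M(Y,\mathbf{w}),Y_{i^*})>\ell_{i^*}(M((Y_{-S},Y'_S),\mathbf{w}),Y_{i^*})$. Here $(Y_{-S},Y'_S)$ is the dataset obtained from $Y$ by replacing $Y_i$ with $Y'_i$ for every $i\in S$. A universally strongly group-strategyproof randomized mechanism is a probability distribution over deterministic strongly group-strategyproof mechanisms. A (possibly randomized) mechanism $M$ is $\rho$-approximate if $\mathbb{E}[L(M(Y,\mathbf{w}),Y,\mathbf{w})]\le\rho\cdot L(\mathrm{erm}(Y,\mathbf{w}),Y,\mathbf{w})$ for every dataset $Y$, the expectation being over the randomness of the mechanism. The statement concerns mechanisms for the problem in general, the approximation ratio being a worst-case guarantee over its inputs. *)

(* Defs.v *)
From HB Require Import structures.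
From mathcomp Require Import all_boot all_order all_algebra finmap.
From mathcomp Require Import all_classical all_reals all_analysis.

Set Implicit Arguments.
Unset Strict Implicit.
Unset Printing Implicit Defensive.

Import Order.TTheory GRing.Theory Num.Theory.

Local Open Scope classical_set_scope.
Local Open Scope ring_scope.

(* MathComp-Analysis.  The labels {+, -} are the booleans, [true] being +. *)

(* The public part of an input: everything except labelings and weights.
   Classically every type is a [choiceType], so [point] is an arbitrary input
   space.  Risk minimization needs a nonempty concept class. *)
Record setting := Setting {
  point : choiceType;
  concepts : set (point -> bool);
  concepts_neq0 : concepts !=set0;
  nagents : nat;
  sample : {fset point}
}.

Arguments concepts s : clear implicits.

(* A set coerces to the type of its elements. *)
Definition classifier (s : setting) : Type := concepts s.

Definition labeling (s : setting) : Type := {ffun sample s -> bool}.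

Definition dataset (s : setting) : Type := 'I_(nagents s) -> labeling s.

Record weights (R : realType) (n : nat) := Weights {
  weight :> 'I_n -> R;
  weight_gt0 : forall i, 0 < weight i;
  weight_sum1 : \sum_i weight i = 1
}.

Definition loss (s : setting) (h : classifier s) (y : labeling s) : nat :=
  #|[pred x : sample s | val h (val x) != y x]|.

Definition risk (R : realType) (s : setting) (h : classifier s)
    (Y : dataset s) (w : weights R (nagents s)) : R :=
  \sum_i w i * (loss h (Y i))%:R.

Lemma erm_exists (R : realType) (s : setting) (Y : dataset s)
    (w : weights R (nagents s)) :
  exists h : classifier s, forall h' : classifier s, risk h Y w <= risk h' Y w.
Proof.
pose pred_of (h : classifier s) : labeling s := [ffun x => val h (val x)].
pose frisk (f : labeling s) : R :=
  \sum_i w i * #|[pred x : sample s | f x != Y i x]|%:R.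
have riskE h : risk h Y w = frisk (pred_of h).
  apply: eq_bigr => i _; congr (_ * _%:R); apply: eq_card => x.
  by rewrite !inE ffunE.
have [g Hg] := concepts_neq0 s.
pose h0 : classifier s := exist _ g (mem_set Hg).
pose achieved (f : labeling s) := `[< exists h, pred_of h = f >].
have ach0 : achieved (pred_of h0) by apply/asboolP; exists h0.
case: (@Order.TotalTheory.arg_minP _ _ _ (pred_of h0) achieved frisk ach0) => f.
move=> /asboolP[h <-] minf; exists h => h'; rewrite !riskE.
by apply: minf; apply/asboolP; exists h'.
Qed.

Definition erm (R : realType) (s : setting) (Y : dataset s)
    (w : weights R (nagents s)) : classifier s :=
  projT1 (cid (erm_exists Y w)).

(* A deterministic mechanism for the problem in general: it answers on every
   setting, dataset and weight vector. *)
Definition mechanism (R : realType) : Type :=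
  forall s : setting, dataset s -> weights R (nagents s) -> classifier s.

(* The dataset (Y_{-S}, Y'_S); the values of [Y'] outside [S] are not used. *)
Definition deviate (s : setting) (Y : dataset s) (S : {set 'I_(nagents s)})
    (Y' : dataset s) : dataset s :=
  fun i => if i \in S then Y' i else Y i.

Definition strongly_group_strategyproof (R : realType) (M : mechanism R) : Prop :=
  forall (s : setting) (w : weights R (nagents s)),
    ~ exists (Y : dataset s) (S : {set 'I_(nagents s)})
             (istar : 'I_(nagents s)) (Y' : dataset s),
        [/\ istar \in S,
            forall i, i \in S ->
              (loss (M s (deviate Y S Y') w) (Y i) <= loss (M s Y w) (Y i))%N &
            (loss (M s (deviate Y S Y') w) (Y istar)
               < loss (M s Y w) (Y istar))%N].

(* A randomized mechanism is a random element [M : Omega -> mechanism R] of a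
   probability space [(Omega, P)].  The only measurability needed for the
   expectations to make sense is that of the risk of its outcomes. *)
Definition randomized_mechanism (R : realType) (d : measure_display)
    (Omega : measurableType d) (M : Omega -> mechanism R) : Prop :=
  forall (s : setting) (Y : dataset s) (w : weights R (nagents s)),
    measurable_fun setT (fun omega => risk (M omega s Y w) Y w).

Definition universally_strongly_gsp (R : realType) (d : measure_display)
    (Omega : measurableType d) (M : Omega -> mechanism R) : Prop :=
  forall omega, strongly_group_strategyproof (M omega).

Definition approximate (R : realType) (d : measure_display)
    (Omega : measurableType d) (P : probability Omega R)
    (M : Omega -> mechanism R) (rho : R) : Prop :=
  forall (s : setting) (Y : dataset s) (w : weights R (nagents s)),
    ('E_P[fun omega => risk (M omega s Y w) Y w]
       <= (rho * risk (erm Y w) Y w)%:E)%E.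

(* Main.v *)
(** With the two constant classifiers on two points, an agent that labels the
    points differently is indifferent between them and may join any coalition
    at no cost.  Hence, once an outcome [b] is opposed by somebody, it cannot be
    changed as long as the supporters of [b] keep their labelings.  For three
    agents this forces every strongly group-strategyproof mechanism to side with
    the first agent against the other two in at least one of the two profiles
    (+,-,-) and (-,+,+).  When the first agent has a small weight [e], the risks
    in these profiles add up to at least [2 (1 - e)], in expectation as well,
    whereas the optimal risks are at most [2 e]. *)
Require Import Defs.
From mathcomp Require Import all_boot all_order all_algebra finmap.
From mathcomp Require Import all_classical all_reals all_analysis.
From mathcomp Require Import measurable_realfun ring lra.

Set Implicit Arguments.
Unset Strict Implicit.
Unset Printing Implicit Defensive.

Import Order.TTheory GRing.Theory Num.Theory.

Local Open Scope classical_set_scope.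
Local Open Scope ring_scope.

Lemma constants_neq0 : range (fun b : bool => fun _ : bool => b) !=set0.
Proof. by exists (fun=> true), true. Qed.

Definition two_constants (n : nat) : setting :=
  Setting constants_neq0 n [fset true; false]%fset.

Section TwoConstants.
Variable n : nat.
Implicit Types (h : classifier (two_constants n)) (o : option bool)
  (t : 'I_n -> option bool) (b : bool).

(** Every concept is constant, so its value at one point determines it. *)
Definition outcome h : bool := val h true.

Definition constant b : classifier (two_constants n) :=
  exist _ (fun=> b) (mem_set (imageT (fun b : bool => fun _ : bool => b) b)).

(* [Some b] is the labeling of an agent preferring the constant [b]; the
   labeling of [None], the identity, makes one mistake on either constant. *)
Definition vote o : labeling (two_constants n) :=
  [ffun x => if o is Some b then b else val x].

Definition profile t : dataset (two_constants n) := fun i => vote (t i).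

Lemma val_classifierE h x : val h x = outcome h.
Proof. by rewrite /outcome; case: h => g /= /set_mem[b _ <-]. Qed.

Lemma loss_vote h o :
  loss h (vote o) = if o is Some b then (outcome h != b).*2 else 1%N.
Proof.
rewrite /loss -sum1_card big_mkcond /=.
pose F (x : bool) : nat := outcome h != (if o is Some b then b else x).
rewrite (eq_bigr (fun x : [fset true; false]%fset => F (val x))); last first.
  by move=> x _; rewrite inE val_classifierE ffunE /F; case: ifP.
rewrite -(big_seq_fsetE addn [fset true; false]%fset xpredT F) /=.
rewrite big_fsetU1 ?inE //= big_seq_fset1 {}/F.
by case: o => [b|]; [rewrite addnn|case: (outcome h)].
Qed.

Lemma outcome_stable (R : realType) (M : mechanism R)
    (w : weights R n) t t' b :
  strongly_group_strategyproof M ->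
  outcome (M (two_constants n) (profile t) w) = b ->
  (exists i, t i = Some (~~ b)) ->
  (forall i, t i = Some b -> t' i = t i) ->
  outcome (M (two_constants n) (profile t') w) = b.
Proof.
move=> gsp tb [i ti] t't; apply/eqP/negPn/negP => t'b.
apply: (gsp (two_constants n) w).
(* The coalition is everybody but the supporters of [b]. If the outcome flipped, its indifferent
   members would still make one mistake, and its opponents of [b], among them [i], would go from two
   mistakes to none. *)
exists (profile t), [set j | t j != Some b]%SET, i, (profile t').
have -> : deviate (profile t) [set j | t j != Some b]%SET (profile t')
    = profile t'.
  apply/funext => j; rewrite /deviate inE /profile.
  by case: eqP => //= /t't ->.
have {}t'b : outcome (M (two_constants n) (profile t') w) = ~~ b.
  by move: t'b; case: outcome; case: (b).
split.
- by rewrite inE ti; case: (b).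
- move=> j; rewrite inE {2 4}/profile !loss_vote tb t'b.
  by case: (t j) => [c|//]; case: c; case: (b).
- by rewrite {2 4}/profile !loss_vote tb t'b ti eqxx; case: (b).
Qed.

End TwoConstants.

Definition votes3 (a b c : option bool) (i : 'I_3) : option bool :=
  nth None [:: a; b; c] i.

Definition lone_voter (b : bool) : 'I_3 -> option bool :=
  votes3 (Some b) (Some (~~ b)) (Some (~~ b)).

Lemma lone_voter_wins (R : realType) (M : mechanism R) (w : weights R 3) :
  strongly_group_strategyproof M ->
  exists b, outcome (M (two_constants 3) (profile (lone_voter b)) w) = b.
Proof.
move=> gsp; pose F a b c :=
  outcome (M (two_constants 3) (profile (votes3 a b c)) w).
have stable a b c a' b' c' v : F a b c = v ->
    [|| a == Some (~~ v), b == Some (~~ v) | c == Some (~~ v)] ->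
    [&& (a == Some v) ==> (a' == a), (b == Some v) ==> (b' == b)
      & (c == Some v) ==> (c' == c)] ->
    F a' b' c' = v.
  move=> Fv opp /and3P[/implyP aa /implyP bb /implyP cc].
  apply: (outcome_stable gsp Fv).
    case/or3P: opp => /eqP opp; [exists ord0 | exists (inord 1) | exists ord_max];
      by rewrite /votes3 ?inordK.
  by move=> [[|[|[|//]]] ?] /eqP/= => [/aa | /bb | /cc] /eqP.
have [?|Ft] := eqVneq (F (Some true) (Some false) (Some false)) true.
  by exists true.
have [?|Ff] := eqVneq (F (Some false) (Some true) (Some true)) false.
  by exists false.
(* Neither lone voter wins from here on. If one won after a member of the majority turned
   indifferent, stability would keep that outcome once this member rejoined the majority. *)
have F3 : F (Some false) None (Some true) = true.
  case E: F => //; move: Ff.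
  by rewrite (stable _ _ _ (Some false) (Some true) (Some true) _ E).
have F2 : F (Some true) (Some false) None = false.
  case E: F => //; move: Ft.
  by rewrite (stable _ _ _ (Some true) (Some false) (Some false) _ E).
(* The first agent, on the losing side in both [F3] and [F2], turns indifferent; both profiles can
   then move to the same one, with opposite outcomes. *)
have := stable _ _ _ None (Some false) (Some true) _ F3 isT isT.
by rewrite (stable _ _ _ None (Some false) (Some true) _ F2).
Qed.

Section LightAgent.
Variables (R : realType) (e : R).
Hypotheses (e_gt0 : 0 < e) (e_lt1 : e < 1).

Definition light_weight (i : 'I_3) : R :=
  if i == ord0 then e else (1 - e) / 2.

Lemma light_weight_gt0 i : 0 < light_weight i.
Proof. by rewrite /light_weight; case: ifP => _ //; rewrite divr_gt0 ?subr_gt0 ?ltr0n. Qed.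

Lemma light_weight_sum1 : \sum_i light_weight i = 1.
Proof. by rewrite !big_ord_recl big_ord0 /light_weight /=; field. Qed.

Definition light_weights : weights R 3 :=
  Weights light_weight_gt0 light_weight_sum1.

Lemma risk_lone_voter (h : classifier (two_constants 3)) b :
  risk h (profile (lone_voter b)) light_weights
    = if outcome h == b then 2 * (1 - e) else 2 * e.
Proof.
rewrite /risk !big_ord_recl big_ord0 /= /light_weight /= /profile !loss_vote /=.
by case: (outcome h); case: b => /=; rewrite -!mul2n !natrM; field.
Qed.

Lemma risk_erm_lone_voter b :
  risk (erm (profile (lone_voter b)) light_weights)
    (profile (lone_voter b)) light_weights <= 2 * e.
Proof.
(* The minimizer is compared with the constant that the two heavy agents prefer. *)
rewrite /erm; case: cid => h /= /(_ (constant 3 (~~ b))).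
by rewrite (risk_lone_voter (constant 3 (~~ b))) /outcome /=; case: b.
Qed.

End LightAgent.

Lemma risk_ge0 (R : realType) (s : setting) (h : classifier s) (Y : dataset s)
  (w : weights R (nagents s)) : 0 <= risk h Y w.
Proof. by apply: sumr_ge0 => i _; rewrite mulr_ge0// ltW// weight_gt0. Qed.

Theorem theorem10 (R : realType) (d : measure_display)
    (Omega : measurableType d) (P : probability Omega R)
    (M : Omega -> mechanism R) :
  randomized_mechanism M ->
  universally_strongly_gsp M ->
  ~ exists rho : R, approximate P M rho.
Proof.
move=> mM gsp [rho appr].
have rho0 := normr_ge0 rho.
(* Chosen so that [4 * |rho| * e < 2 * (1 - e)], that is, [(2 * |rho| + 1) * e < 1]. *)
pose e : R := (2 * `|rho| + 2)^-1.
have e_gt0 : 0 < e by rewrite invr_gt0; lra.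
have eE : (2 * `|rho| + 2) * e = 1 by rewrite divff//; apply: lt0r_neq0; lra.
have e_lt1 : e < 1 by nra.
pose w := light_weights e_gt0 e_lt1.
pose f b (omega : Omega) : R :=
  risk (M omega (two_constants 3) (profile (lone_voter b)) w)
    (profile (lone_voter b)) w.
have f_ge0 b omega : 0 <= f b omega by exact: risk_ge0.
have Ef b : ('E_P[f b] <= (`|rho| * (2 * e))%:E)%E.
  apply: le_trans (appr (two_constants 3) (profile (lone_voter b)) w) _.
  rewrite lee_fin (le_trans (ler_wpM2r (risk_ge0 _ _ _) (ler_norm rho)))//.
  exact: ler_wpM2l (risk_erm_lone_voter _ _ _).
(* The winning [b] may vary with [omega], so the pointwise bound is on the sum of both risks. *)
have fD omega : 2 * (1 - e) <= f true omega + f false omega.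
  have [b wins] := lone_voter_wins w (gsp omega).
  have fb : f b omega = 2 * (1 - e) by rewrite /f risk_lone_voter wins eqxx.
  have := f_ge0 (~~ b) omega.
  by case: (b) fb => /= -> ?; lra.
have mf b : measurable_fun setT (f b) by exact: mM.
have : ((2 * (1 - e))%:E <= 'E_P[f true] + 'E_P[f false])%E.
  rewrite !unlock -ge0_integralD//; last 4 first.
  - by move=> x _; rewrite lee_fin.
  - exact/measurable_EFinP.
  - by move=> x _; rewrite lee_fin.
  - exact/measurable_EFinP.
  (* The total mass is 1, so the constant equals its own integral. *)
  rewrite -[leLHS]mule1 -(@probability_setT _ _ _ P) -integral_cst//.
  apply: ge0_le_integral => //.
  - by move=> x _; rewrite lee_fin; lra.
  - by apply: emeasurable_funD; exact/measurable_EFinP.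
  - by move=> x _; rewrite -EFinD lee_fin.
move=> /le_trans/(_ (leeD (Ef true) (Ef false))).
by rewrite -EFinD lee_fin; nra.
Qed.
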